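(* Let $a,b \ge 1$ be integers and let $\mathcal{G}$ be a chi-bounded hereditary class of graphs all of which are $bK_a$-free. There exists $C=C(\mathcal{G})>0$ such that every $G \in \mathcal{G}$ satisfies $$i(G) \le |G|^{C} \cdot 2^{C\alpha(G)}.$$
   Context: $bK_a$ denotes the disjoint union of $b$ copies of the complete graph $K_a$. A graph is $H$-free if it does not contain $H$ as an induced subgraph. A hereditary class of graphs (closed under taking induced subgraphs) $\mathcal{G}$ is chi-bounded if there is a function $g:\mathbb{N}\to\mathbb{R}$ with $\chi(G)\le g(\omega(G))$ for all $G\in\mathcal{G}$, where $\chi$ is the chromatic number and $\omega$ the clique number. $|G|$ is the number of vertices of $G$, $\alpha(G)$ its independence number, and $i(G)$ the number of independent sets of $G$, where the empty set is counted as an independent set. *)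

(* Defs.v *)
From mathcomp Require Import all_boot all_order all_algebra.
From mathcomp Require Import reals.

Set Implicit Arguments.
Unset Strict Implicit.
Unset Printing Implicit Defensive.

(* The vertex set may be empty. *)
Record sgraph := SGraph {
  vertex :> finType;
  adj : rel vertex;
  adj_sym : symmetric adj;
  adj_irr : irreflexive adj }.

Definition induced_adj (G : sgraph) (S : {set G}) : rel {x : G | x \in S} :=
  fun x y => adj (val x) (val y).

Lemma induced_adj_sym (G : sgraph) (S : {set G}) : symmetric (@induced_adj G S).
Proof. by move=> x y; apply: adj_sym. Qed.

Lemma induced_adj_irr (G : sgraph) (S : {set G}) :
  irreflexive (@induced_adj G S).
Proof. by move=> x; apply: adj_irr. Qed.

Definition induced (G : sgraph) (S : {set G}) : sgraph :=
  SGraph (@induced_adj_sym G S) (@induced_adj_irr G S).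

Definition isomorphic (G H : sgraph) : Prop :=
  exists2 f : G -> H, bijective f & forall x y, adj (f x) (f y) = adj x y.

Definition induced_free (H G : sgraph) : Prop :=
  ~ exists S : {set G}, isomorphic H (induced S).

(* In the union of b copies of K_a, the vertex (i, j) is the j-th vertex of
   the i-th copy. *)
Definition copiesK_adj (b a : nat) : rel ('I_b * 'I_a) :=
  fun x y => (x.1 == y.1) && (x.2 != y.2).

Lemma copiesK_adj_sym (b a : nat) : symmetric (@copiesK_adj b a).
Proof. by move=> x y; rewrite /copiesK_adj eq_sym [x.2 == _]eq_sym. Qed.

Lemma copiesK_adj_irr (b a : nat) : irreflexive (@copiesK_adj b a).
Proof. by move=> x; rewrite /copiesK_adj !eqxx. Qed.

Definition copiesK (b a : nat) : sgraph :=
  SGraph (@copiesK_adj_sym b a) (@copiesK_adj_irr b a).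

Definition stable (G : sgraph) (S : {set G}) : bool :=
  [forall x in S, forall y in S, ~~ adj x y].

Definition clique (G : sgraph) (S : {set G}) : bool :=
  [forall x in S, forall y in S, (x != y) ==> adj x y].

Definition alpha (G : sgraph) : nat := \max_(S : {set G} | stable S) #|S|.

Definition omega (G : sgraph) : nat := \max_(S : {set G} | clique S) #|S|.

Definition num_stable (G : sgraph) : nat := #|[set S : {set G} | stable S]|.

Definition colorable (G : sgraph) (k : nat) : bool :=
  [exists c : {ffun G -> 'I_k}, forall x, forall y, adj x y ==> (c x != c y)].

Lemma colorable_card (G : sgraph) : exists k, colorable G k.
Proof.
exists #|G|; apply/existsP; exists [ffun x => enum_rank x].
apply/forallP=> x; apply/forallP=> y; apply/implyP=> xy.
rewrite !ffunE (inj_eq enum_rank_inj).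
by apply: contraTneq xy => ->; rewrite adj_irr.
Qed.

Definition chi (G : sgraph) : nat := ex_minn (colorable_card G).

(* Closure under isomorphism is not required. *)
Definition hereditary (cG : sgraph -> Prop) : Prop :=
  forall (G : sgraph) (S : {set G}), cG G -> cG (induced S).

Definition chi_bounded (R : realType) (cG : sgraph -> Prop) : Prop :=
  exists g : nat -> R, forall G, cG G -> ((chi G)%:R <= g (omega G))%R.

(* Main.v *)
(** Fix [G] and induct on [b], counting the stable sets inside a vertex subset
    [S].  If [S] is [K_a]-free, chi-boundedness gives [#|S| <= k * alpha G], so
    there are at most [2 ^ (k * alpha G)] of them.  Otherwise, for a stable set
    [I] of [S] let [J] be a maximal subset of [I] that is anticomplete to some
    [a]-clique [K] of [S].  Then [J] lies in the part of [S] anticomplete to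
    [K], which has one fewer [K_a], so induction bounds the number of choices
    of [J].  If [J != I], pick [v] in [I] outside [J]: by maximality the part
    of [S] anticomplete to [J + v] is [K_a]-free, and the rest of [I] lies in
    it.  Hence passing from [b] to [b + 1] costs at most a factor
    [n ^ a * (n + 1) * 2 ^ (k * alpha G)]. *)
Require Import Defs.
From mathcomp Require Import all_boot all_order all_algebra.
From mathcomp Require Import reals exp.

Set Implicit Arguments.
Unset Strict Implicit.
Unset Printing Implicit Defensive.

(** A union bound. It serves for the colour classes of a colouring and for each layer of choices in
    the count of stable sets. *)
Lemma card_cover (I T : finType) (P : {set I}) (B : I -> {set T})
    (A : {set T}) (m : nat) :
  (forall x, x \in A -> exists2 i, i \in P & x \in B i) ->
  (forall i, i \in P -> #|B i| <= m) -> #|A| <= #|P| * m.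
Proof.
move=> covA cardB; rewrite -sum_nat_const.
apply: (@leq_trans (\sum_(i in P) #|B i|)); last exact: leq_sum.
have AB : A \subset \bigcup_(i in P) B i.
  by apply/subsetP => x /covA[i Pi xBi]; apply/bigcupP; exists i.
apply: leq_trans (subset_leq_card AB) _.
elim/big_rec2: _ => [|i m' U _ leUm]; first by rewrite cards0.
by rewrite (leq_trans (leq_card_setU _ _)) // leq_add2l.
Qed.

Section StableSets.
Variables (G : sgraph) (a : nat).
Implicit Types (S I J : {set G}) (f : {ffun 'I_a -> G}).

Lemma stableP S : reflect {in S &, forall x y, ~~ adj x y} (stable S).
Proof.
apply: (iffP forall_inP) => [st x y xS yS|st x xS].
  exact: (forall_inP (st x xS)).
by apply/forall_inP => y; apply: st.
Qed.

Lemma stableS I J : J \subset I -> stable I -> stable J.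
Proof.
move=> /subsetP JI /stableP st; apply/stableP => x y xJ yJ.
by apply: st; apply: JI.
Qed.

Lemma alpha_gt0 : 0 < #|G| -> 0 < alpha G.
Proof.
case/card_gt0P => x _; rewrite -(cards1 x).
apply: (@leq_bigmax_cond _ _ (fun S : {set G} => #|S|)).
by apply/stableP => y z /set1P-> /set1P->; rewrite adj_irr.
Qed.

Definition stable_in S : {set {set G}} := [set I | stable I & I \subset S].

(** Cliques are labelled by ['I_a], so at most [#|G| ^ a] of them exist. The adjacency equation
    makes [f] injective. *)
Definition clique_in S f : bool :=
  [forall i, f i \in S] && [forall i, forall j, adj (f i) (f j) == (i != j)].

Lemma clique_inP S f :
  reflect ((forall i, f i \in S) /\ forall i j, adj (f i) (f j) = (i != j))
          (clique_in S f).
Proof.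
apply: (iffP andP) => [[/forallP fS /forallP fadj]|[fS fadj]].
  by split=> // i j; apply/eqP/(forallP (fadj i)).
by split; apply/forallP => // i; apply/forallP => j; apply/eqP.
Qed.

(** Since [adj] is irreflexive, the clause [x != y] is what removes [I] itself when [I] is
    stable. *)
Definition away S I : {set G} :=
  [set x in S | [forall y in I, (x != y) && ~~ adj x y]].

Lemma awayP S I x :
  reflect (x \in S /\ forall y, y \in I -> x != y /\ ~~ adj x y)
          (x \in away S I).
Proof.
rewrite inE; apply: (iffP andP) => -[xS xI]; split=> //.
  by move=> y yI; apply/andP; apply: (forall_inP xI).
by apply/forall_inP => y /xI/andP.
Qed.

Definition support f : {set G} := [set f i | i : 'I_a].

(** This recursive form of [b] pairwise anticomplete [a]-cliques lets its negation pass from [S] to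
    the part of [S] away from a clique. *)
Fixpoint packs b S : Prop :=
  if b is b'.+1 then
    exists2 f, clique_in S f & packs b' (away S (support f))
  else True.

(** The first clique becomes copy [ord0], and the copies given by induction are shifted by
    [lift ord0]. *)
Lemma packs_embedding b S : packs b S ->
  exists f : 'I_b * 'I_a -> G, [/\ injective f, forall x, f x \in S
    & forall x y, adj (f x) (f y) = copiesK_adj x y].
Proof.
elim: b S => [|b IHb] S /=.
  have no (x : 'I_0 * 'I_a) : False by case: x => [[]].
  by exists (fun x => False_rect G (no x)); split=> x; case: (no x).
case=> f /clique_inP[fS fadj] /IHb[h [injh hS hadj]].
pose F (x : 'I_b.+1 * 'I_a) :=
  if unlift ord0 x.1 is Some i then h (i, x.2) else f x.2.
have hf i j k : h (i, j) != f k /\ ~~ adj (h (i, j)) (f k).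
  by case/awayP: (hS (i, j)) => _; apply; apply: imset_f.
have injf : injective f.
  by move=> i j fij; apply/eqP; rewrite -[_ == _]negbK -fadj fij adj_irr.
exists F; rewrite /F /copiesK_adj; split=> [[i j] [i' j']|[i j]|[i j] [i' j']] /=.
- case: unliftP => [k|] ->; case: unliftP => [k'|] -> //.
  + by case/injh=> -> ->.
  + by case: (hf k j j') => /eqP.
  + by move/esym; case: (hf k' j' j) => /eqP.
  + by move/injf->.
- by case: unliftP => [k|] _ //; case/awayP: (hS (k, j)).
- case: unliftP => [k|] ->; case: unliftP => [k'|] ->.
  + by rewrite hadj /copiesK_adj /= (inj_eq lift_inj).
  + rewrite eq_sym (negPf (neq_lift _ _)) /=.
    by case: (hf k j j') => _ /negPf.
  + rewrite (negPf (neq_lift _ _)) /= adj_sym.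
    by case: (hf k' j' j) => _ /negPf.
  + by rewrite eqxx fadj.
Qed.

Lemma induced_free_packs b :
  induced_free (copiesK b a) G -> ~ packs b [set: G].
Proof.
move=> free /packs_embedding[f [injf _ fadj]]; apply: free.
exists (f @: [set: 'I_b * 'I_a]).
have fI x : f x \in f @: [set: 'I_b * 'I_a] by apply: imset_f.
exists (fun x => exist _ (f x) (fI x) : induced _); last first.
  by move=> x y; apply: fadj.
apply: inj_card_bij => [x y /(congr1 val)/injf //|].
by rewrite card_sig (@eq_card _ _ (mem (f @: setT))) // card_imset // cardsT.
Qed.

(** Enumerate a maximum clique and keep its first [a] vertices. *)
Lemma clique_in_omega S : a <= omega (induced S) -> exists f, clique_in S f.
Proof.
case: (@eq_bigmax_cond _ [pred C : {set induced S} | clique C]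
         (fun C => #|C|)).
  apply/card_gt0P; exists set0; apply/forall_inP => x.
  by rewrite in_set0.
move=> C clC eqC; rewrite /omega; rewrite eqC => leaC.
exists [ffun i => val (enum_val (widen_ord leaC i))].
apply/clique_inP; split=> [i|i j]; rewrite !ffunE; first exact: valP.
have -> : (i != j) = (enum_val (widen_ord leaC i)
                        != enum_val (widen_ord leaC j)).
  by rewrite (inj_eq enum_val_inj).
case: eqVneq => [->|ne]; first by rewrite adj_irr.
have := forall_inP clC _ (enum_valP (widen_ord leaC i)).
by move/forall_inP/(_ _ (enum_valP (widen_ord leaC j)))/implyP/(_ ne).
Qed.

(** Each colour class is stable in [G], hence has at most [alpha G] vertices. *)
Lemma card_colorable S k : colorable (induced S) k -> #|S| <= k * alpha G.
Proof.
case/existsP => c /forallP cP; rewrite -[k in k * _]card_ord -cardsT.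
apply: (@card_cover _ _ _ (fun i => val @: [set x | c x == i])).
  move=> x xS; exists (c (exist _ x xS)); first by rewrite inE.
  by apply/imsetP; exists (exist _ x xS); rewrite ?inE.
move=> i _; apply: (@leq_bigmax_cond _ _ (fun S : {set G} => #|S|)).
apply/stableP => _ _ /imsetP[x + ->] /imsetP[y + ->].
rewrite !inE => /eqP cx /eqP cy; apply/negP => xy.
by have /forallP/(_ y)/implyP/(_ xy) := cP x; rewrite cx cy eqxx.
Qed.

Lemma card_stable_in S : #|stable_in S| <= 2 ^ #|S|.
Proof.
rewrite -card_powerset; apply/subset_leq_card/subsetP => I.
by rewrite !inE => /andP[].
Qed.

Lemma card_stable_packs (k b : nat) S :
    0 < #|G| ->
    (forall T : {set G}, ~~ [exists f, clique_in T f] -> #|T| <= k * alpha G) ->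
  ~ packs b S ->
  #|stable_in S| <= (#|G| ^ a.+1 * 2 ^ (k.+1 * alpha G)) ^ b.
Proof.
(* The case [b = 0] is void because [packs 0 S] always holds; the clique-free case is treated inside
   the successor step. *)
move=> n_gt0 cliquefree; elim: b S => [|b IHb] S nopack; first by case: nopack.
have free_card T : ~~ [exists f, clique_in T f] ->
    #|stable_in T| <= 2 ^ (k * alpha G).
  move=> /cliquefree leT; apply: leq_trans (card_stable_in T) _.
  by rewrite leq_exp2l.
set M := #|G| ^ _ * _.
have M_gt0 : 0 < M by rewrite muln_gt0 !expn_gt0 n_gt0.
have [/existsP[f0 f0S]|nocl] := boolP [exists f, clique_in S f]; last first.
  apply: leq_trans (free_card _ nocl) _.
  rewrite expnS -[X in X <= _]muln1 leq_mul ?expn_gt0 ?M_gt0 //.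
  rewrite -[X in X <= _]mul1n leq_mul ?expn_gt0 ?n_gt0 //.
  by rewrite leq_exp2l // leq_mul.
pose missed J := [exists f, clique_in S f && (J \subset away S (support f))].
(* The slot [None] stands for the case [I = J], and [Some v] for the choice of
   a vertex [v] such that [v |: J] meets or neighbours every clique. *)
pose B J (o : option G) : {set {set G}} :=
  if o is Some v then
    if missed (v |: J) || ~~ (v |: J \subset S) then set0
    else [set I in stable_in S | v |: J \subset I]
  else [set J].
(* The stable sets charged to the clique [f]: first choose [J] away from [f], then the slot [o]. *)
pose BJ f : {set {set G}} :=
  \bigcup_(J in stable_in (away S (support f))) \bigcup_o B J o.
have card_cl : #|[set f | clique_in S f]| <= #|G| ^ a.
  by rewrite -[a in _ ^ a]card_ord -card_ffun max_card.
have cardB J o : #|B J o| <= 2 ^ (k * alpha G).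
  case: o => [v|] /=; last by rewrite cards1 expn_gt0.
  case: ifPn => [_|]; first by rewrite cards0.
  set W := v |: J; rewrite negb_or negbK => /andP[hit WS].
  (* Being anticomplete is symmetric: a clique away from [W] would make [W] missed. *)
  have nofree : ~~ [exists f, clique_in (away S W) f].
    apply: contra hit => /existsP[f /clique_inP[fS fadj]].
    apply/existsP; exists f; apply/andP; split.
      by apply/clique_inP; split=> // i; case/awayP: (fS i).
    apply/subsetP => w wW; apply/awayP; split.
      by move/subsetP: WS; apply.
    move=> _ /imsetP[i _ ->]; case/awayP: (fS i) => _ /(_ w wW)[ne nadj].
    by rewrite eq_sym adj_sym.
  apply: leq_trans (free_card _ nofree).
  (* As [W] is contained in [I], the set [I] is recovered from [I :\: W], which is a stable set of
     [away S W]. *)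
  rewrite -(card_in_imset (f := fun I => I :\: W)); last first.
    move=> I I'; rewrite !inE => /andP[_ WI] /andP[_ WI'] eqD.
    by rewrite -(setID I W) -(setID I' W) eqD (setIidPr WI) (setIidPr WI').
  apply/subset_leq_card/subsetP => _ /imsetP[I + ->].
  rewrite inE [I \in _]inE => /andP[/andP[stI IS] WI].
  rewrite inE (stableS (subsetDl I W) stI) /=.
  apply/subsetP => x /setDP[xI xW]; apply/awayP; split.
    by move/subsetP: IS; apply.
  move=> y yW; split; first by apply: contraNneq xW => ->.
  by move/stableP: stI; apply=> //; move/subsetP: WI; apply.
have cardBJ f : clique_in S f ->
    #|BJ f| <= M ^ b * (#|G|.+1 * 2 ^ (k * alpha G)).
  move=> fS; set T := away S (support f).
  have le1 : #|BJ f| <= #|stable_in T| * (#|G|.+1 * 2 ^ (k * alpha G)).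
    apply: (card_cover (B := fun J => \bigcup_o B J o)) => [I /bigcupP//|J _].
    rewrite -card_option -cardsT; apply: (card_cover (B := B J)) => // I.
    by case/bigcupP => o _; exists o.
  apply: leq_trans le1 _; rewrite leq_mul2r IHb ?orbT // => packT.
  by apply: nopack; exists f.
have cover I : I \in stable_in S ->
    exists2 f, f \in [set f | clique_in S f] & I \in BJ f.
  rewrite inE => /andP[stI IS].
  (* The clique [f0] shows that the empty set is missed, so a maximal [J] exists. *)
  have /ex_maxset[J /maxsetP[/andP[JI missJ] maxJ]] :
      exists J, (J \subset I) && missed J.
    exists set0; rewrite sub0set; apply/existsP; exists f0.
    by rewrite f0S sub0set.
  case/existsP: missJ => f /andP[fS JT].
  exists f; rewrite ?inE //; apply/bigcupP; exists J.
    by rewrite inE (stableS JI stI).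
  have [eqJI|neJI] := eqVneq J I.
    by apply/bigcupP; exists None; rewrite // inE eqJI.
  have /properP[_ [v vI vJ]] : J \proper I by rewrite properEneq neJI.
  have vJI : v |: J \subset I by rewrite subUset sub1set vI.
  apply/bigcupP; exists (Some v) => //=; case: ifPn => [|_].
    rewrite (subset_trans vJI IS) orbF => missv.
    have eqvJ : v |: J = J by apply: maxJ; rewrite ?vJI ?subsetUr.
    by rewrite -eqvJ setU11 in vJ.
  by rewrite !inE stI IS.
apply: leq_trans (card_cover cover _) _.
  by move=> f; rewrite inE; apply: cardBJ.
apply: leq_trans (leq_mul card_cl (leqnn _)) _.
rewrite mulnCA expnS [M * _]mulnC leq_mul2l; apply/orP; right.
rewrite /M expnSr -!mulnA leq_mul2l; apply/orP; right.
rewrite mulSn expnD mulnA -mulSn leq_mul2r; apply/orP; right.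
(* Here [n + 1 <= 2 * n <= n * 2 ^ alpha G], as [alpha G] is positive; this is the source of the
   exponents [a.+1] and [k.+1]. *)
apply: (@leq_trans (#|G| * 2)); first by rewrite muln2 -addnn -addn1 leq_add2l.
by rewrite leq_mul2l -[X in X <= _]expn1 leq_exp2l // alpha_gt0 // orbT.
Qed.

Lemma num_stable_le (k b : nat) : 0 < #|G| ->
    (forall S : {set G}, omega (induced S) < a -> chi (induced S) <= k) ->
    induced_free (copiesK b a) G ->
  num_stable G <= (#|G| ^ a.+1 * 2 ^ (k.+1 * alpha G)) ^ b.
Proof.
move=> n_gt0 chik /induced_free_packs free.
have -> : num_stable G = #|stable_in setT|.
  by apply: eq_card => I; rewrite !inE subsetT andbT.
apply: card_stable_packs => // S nocl.
have ltom : omega (induced S) < a.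
  rewrite ltnNge; apply: contra nocl => /clique_in_omega[f fS].
  by apply/existsP; exists f.
have colS : colorable (induced S) (chi (induced S)).
  by rewrite /chi; case: ex_minnP.
by apply: leq_trans (card_colorable colS) _; rewrite leq_mul2r chik ?orbT.
Qed.
End StableSets.

Import Order.TTheory GRing.Theory Num.Theory.
Local Open Scope ring_scope.

(** The function [g] need not be monotone or integral, so [k] is the maximum of natural bounds for
    its finitely many values below [a]. *)
Lemma chi_bounded_nat (R : realType) (cG : sgraph -> Prop) (a : nat) :
  chi_bounded R cG ->
  exists k : nat, forall G, cG G -> (omega G < a)%N -> (chi G <= k)%N.
Proof.
case=> g gP; exists (\max_(i < a) Num.bound `|g i|)%N => G GcG ltom.
apply: leq_trans (leq_bigmax (Ordinal ltom)); rewrite -(ler_nat R).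
apply: le_trans (gP G GcG) _; apply: le_trans (ler_norm _) _.
exact/ltW/archi_boundP.
Qed.

Theorem theorem4p2 (R : realType) (a b : nat) (ha : (1 <= a)%N)
    (hb : (1 <= b)%N) (cG : sgraph -> Prop) (hered : hereditary cG)
    (bounded : chi_bounded R cG)
    (bKa_free : forall G, cG G -> induced_free (copiesK b a) G) :
  exists C : R, 0 < C /\
    forall G : sgraph, cG G -> (0 < #|G|)%N ->
      (num_stable G)%:R <= #|G|%:R `^ C * 2 `^ (C * (alpha G)%:R).
Proof.
have [k kP] := chi_bounded_nat a bounded.
(* The exponents to dominate are [a.+1 * b] for [#|G|] and [k.+1 * b * alpha G] for [2]. A natural
   constant turns the real powers into natural ones. *)
exists ((a.+1 + k.+1) * b)%:R; split; first by rewrite ltr0n muln_gt0 hb.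
(* For the empty graph the bound would read [1 <= 0], hence the assumption [n_gt0]. *)
move=> G GcG n_gt0.
rewrite -natrM !powR_mulrn ?ler0n // -!natrX -natrM ler_nat.
apply: leq_trans (num_stable_le n_gt0 _ (bKa_free _ GcG)) _.
  by move=> S; apply/kP/hered.
rewrite expnMn -!expnM leq_mul //.
  by rewrite leq_pexp2l // leq_mul2r leq_addr orbT.
by rewrite leq_pexp2l // mulnAC !leq_mul2r leq_addl !orbT.
Qed.
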